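(* Let $V$ be a Banach space whose algebraic tensor powers carry norms as described in the context, and let $n\ge 1$. Then the function $\|\cdot\|_{\tilde{T}^{(n)}(V)}$ is symmetric on $G^{(n)}$ in the sense that for all $g\in G^{(n)}$, $$\|g\|_{\tilde{T}^{(n)}(V)}=\|g^{-1}\|_{\tilde{T}^{(n)}(V)}.$$
   Context: $V$ is a Banach space; $V^{\otimes_a k}$ is the $k$-fold algebraic tensor power of $V$ ($V^{\otimes_a 1}=V$). Each $V^{\otimes_a k}$ carries a norm $\|\cdot\|_{V^{\otimes_a k}}$ such that: (1) $\|a\otimes b\|_{V^{\otimes_a(m+n)}}\le \|a\|_{V^{\otimes_a m}}\|b\|_{V^{\otimes_a n}}$ for $a\in V^{\otimes_a m}$, $b\in V^{\otimes_a n}$; (2) for every $n\in\mathbb{N}$, every permutation $\sigma$ of $\{1,\dots,n\}$ and all $v_1,\dots,v_n\in V$, $\|v_1\otimes\cdots\otimes v_n\|_{V^{\otimes_a n}}=\|v_{\sigma(1)}\otimes\cdots\otimes v_{\sigma(n)}\|_{V^{\otimes_a n}}$. $V^{\otimes k}$ denotes the completion of $V^{\otimes_a k}$; multiplication $\otimes$ extends to $V^{\otimes m}\times V^{\otimes n}\to V^{\otimes (m+n)}$. $\tilde{T}^{(n)}(V)=1\oplus V\oplus V^{\otimes 2}\oplus\cdots\oplus V^{\otimes n}$ is the set of truncated tensor series $a=(a_0,\dots,a_n)$ with $a_0=1$, $a_k\in V^{\otimes k}$, a group under truncated multiplication $(a\otimes b)_k=\sum_{i=0}^k a_i\otimes b_{k-i}$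 with identity $\mathbf{1}=(1,0,\dots,0)$; $g^{-1}$ is the inverse in this group. $\pi_k$ is the projection to $V^{\otimes k}$. Define $$\|g\|_{\tilde{T}^{(n)}(V)}=\max_{1\le k\le n}\|\pi_k(g)\|_{V^{\otimes k}}^{1/k}.$$ Let $[x,y]=x\otimes y-y\otimes x$, $L_a^1(V)=V$, $L_a^{k+1}(V)=\mathrm{Span}\{[x,y]:x\in L_a^k(V),\,y\in V\}$, and $\mathcal{L}_a^n(V)=\bigoplus_{i=1}^n L_a^i(V)$. Put $\exp(l)=\sum_{j=0}^n l^{\otimes j}/j!$, truncated to degrees at most $n$ ($l^{\otimes 0}=\mathbf{1}$). $G^{(n)}$ is the closure of $\exp\mathcal{L}_a^n(V)$ in $\tilde{T}^{(n)}(V)$.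
   Formalization: Condition (2) is strengthened: permuting factors must be isometric on all of V^{⊗_a k} (finite sums of pure tensors), not only on single pure tensors, because with (2) as stated the claim fails for a norm on R^2⊗R^2; V is a real Banach space. *)

(* Defs.v *)
From HB Require Import structures.
From mathcomp Require Import all_boot all_order all_fingroup all_algebra.
From mathcomp Require Import all_classical all_reals all_analysis.

Set Implicit Arguments.
Unset Strict Implicit.
Unset Printing Implicit Defensive.

Import Order.TTheory GRing.Theory Num.Theory.
Import numFieldNormedType.Exports.

Local Open Scope classical_set_scope.
Local Open Scope ring_scope.

Section AlgebraicTensors.
Context {R : realType}.

Definition upd {V : Type} {k : nat} (v : 'I_k -> V) (i : 'I_k) (x : V) :
    'I_k -> V :=
  fun j => if j == i then x else v j.

Definition multilinear {V W : lmodType R} {k : nat} (f : ('I_k -> V) -> W) :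
    Prop :=
  forall (i : 'I_k) (v : 'I_k -> V) (a : R) (x y : V),
    f (upd v i (a *: x + y)) = a *: f (upd v i x) + f (upd v i y).

(* The k-fold algebraic tensor power, characterised up to unique isomorphism
   by its universal property.  For k = 0 it is a line spanned by [t v], with v
   the empty family. *)
Definition is_tensor_power {V A : lmodType R} {k : nat}
    (t : ('I_k -> V) -> A) : Prop :=
  multilinear t /\
  forall (W : lmodType R) (f : ('I_k -> V) -> W), multilinear f ->
    exists! g : A -> W, linear g /\ forall v, g (t v) = f v.

Definition fcat {V : Type} {m n : nat} (v : 'I_m -> V) (w : 'I_n -> V) :
    'I_(m + n) -> V :=
  fun i => match fintype.split i with inl j => v j | inr j => w j end.

Definition bilinear_map {U V W : lmodType R} (f : U -> V -> W) : Prop :=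
  (forall v, linear (fun u => f u v)) /\ (forall u, linear (f u)).

Definition linear_span {W : lmodType R} (S : set W) : set W :=
  [set x | exists (N : nat) (c : 'I_N -> R) (s : 'I_N -> W),
     (forall i, S (s i)) /\ x = \sum_(i < N) c i *: s i].

End AlgebraicTensors.

(* The algebraic tensor powers of V with their norms.  In degree 0 the tensor
   power is R with the absolute value, and in degree 1 it is V with its own
   norm.
   [norm_perm] says that permuting tensor factors is isometric on the whole
   k-th tensor power: each of its elements is a finite sum of pure tensors
   (scalars can be absorbed in the factors), and N = 1 is the case of a single
   pure tensor v_1 (x) ... (x) v_k.  Pure tensors alone would not be enough:
   such an equality does not extend by linearity, and there are norms on
   R^2 (x) R^2 satisfying it on pure tensors for which the homogeneous norm
   [tnorm] below is not symmetric. *)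
Record tensor_norms (R : realType) (V : completeNormedModType R) :=
  TensorNorms {
  atp : nat -> normedModType R;
  tens : forall k : nat, ('I_k -> V) -> atp k;
  tensP : forall k : nat, is_tensor_power (@tens k);
  amul : forall m n : nat, atp m -> atp n -> atp (m + n);
  amul_bilinear : forall m n : nat, bilinear_map (@amul m n);
  amul_tens : forall (m n : nat) (v : 'I_m -> V) (w : 'I_n -> V),
    amul (tens v) (tens w) = tens (fcat v w);
  norm_tens0 : forall v : 'I_0 -> V, `|tens v| = 1;
  norm_tens1 : forall v : 'I_1 -> V, `|tens v| = `|v ord0|;
  norm_amul : forall (m n : nat) (a : atp m) (b : atp n),
    `|amul a b| <= `|a| * `|b|;
  norm_perm : forall (k N : nat) (s : 'S_k) (v : 'I_N -> 'I_k -> V),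
    `|\sum_(j < N) tens (v j)| = `|\sum_(j < N) tens (fun i => v j (s i))|
}.

(* Completions of the algebraic tensor powers (complete spaces with a dense
   linear isometric embedding), with the continuous extension of the
   multiplication; all of this is unique up to unique isomorphism. *)
Record tensor_completion (R : realType) (V : completeNormedModType R)
    (T : tensor_norms V) := TensorCompletion {
  ctp : nat -> completeNormedModType R;
  emb : forall k : nat, atp T k -> ctp k;
  emb_linear : forall k : nat, linear (@emb k);
  emb_isometry : forall (k : nat) (a : atp T k), `|emb a| = `|a|;
  emb_dense : forall k : nat, dense (range (@emb k));
  cmul : forall m n : nat, ctp m -> ctp n -> ctp (m + n);
  cmul_bilinear : forall m n : nat, bilinear_map (@cmul m n);
  cmul_continuous : forall m n : nat,
    continuous (fun p : ctp m * ctp n => cmul p.1 p.2);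
  cmul_emb : forall (m n : nat) (a : atp T m) (b : atp T n),
    cmul (emb a) (emb b) = emb (amul a b)
}.

Section TruncatedSeries.
Context {R : realType} {V : completeNormedModType R} {T : tensor_norms V}.
Variables (C : tensor_completion T) (n : nat).

(* Series (a_0, ..., a_n) with a_0 arbitrary; those with a_0 = 1 form [tseries1]. *)
Definition tseries := prod_topology (fun k : 'I_n.+1 => ctp C k).

Definition tone : tseries := fun k =>
  match nat_of_ord k as m return ctp C m with
  | 0 => emb C (tens T (fun i : 'I_0 => 0))
  | m.+1 => 0
  end.

Definition le_ord {k : 'I_n.+1} (i : 'I_k.+1) : 'I_n.+1 :=
  widen_ord (ltn_ord k) i.

Definition tmul (a b : tseries) : tseries := fun k : 'I_n.+1 =>
  \sum_(i < k.+1)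
    ecast m (ctp C m) (subnKC (ltn_ord i : (i <= k)%N))
      (cmul (a (le_ord i)) (b (le_ord (sub_ord i)))).

Definition texpn (a : tseries) (j : nat) : tseries := iter j (tmul a) tone.

Definition tseries1 : set tseries := [set a : tseries | a ord0 = tone ord0].

Definition tinv (g : tseries) : tseries :=
  xget tone [set h | [/\ tseries1 h, tmul g h = tone & tmul h g = tone]].

Definition tnorm (g : tseries) : R :=
  \big[Num.max/0]_(k < n.+1 | (0 < k)%N) (`|g k| `^ (k%:R)^-1).

(* [lie_power k] is the subspace L_a^{k+1}(V) of the (k+1)-st tensor power;
   the first one is all of V. *)
Definition bracket {k : nat} (x : atp T k.+1) (y : atp T 1) : atp T k.+2 :=
  ecast m (atp T m) (addn1 k.+1) (amul x y) - (amul y x : atp T k.+2).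

Fixpoint lie_power (k : nat) : set (atp T k.+1) :=
  match k return set (atp T k.+1) with
  | 0 => setT
  | j.+1 => linear_span [set z | exists (x : atp T j.+1) (y : atp T 1),
                            @lie_power j x /\ z = bracket x y]
  end.

Definition lie_comp (k : nat) : set (atp T k) :=
  match k return set (atp T k) with
  | 0 => [set 0]
  | j.+1 => @lie_power j
  end.

Definition lie_algebra : set tseries :=
  [set l | forall k : 'I_n.+1,
             exists x : atp T k, lie_comp x /\ l k = emb C x].

Definition texp (l : tseries) : tseries := fun k =>
  \sum_(j < n.+1) (j`!%:R : R)^-1 *: texpn l j k.

Definition lie_group : set tseries :=
  [set g | tseries1 g /\ closure (texp @` lie_algebra) g].

End TruncatedSeries.

(* Main.v *)
Require Import Defs.
From HB Require Import structures.
From mathcomp Require Import all_boot all_order all_fingroup all_algebra.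
From mathcomp Require Import all_classical all_reals all_analysis.
From mathcomp Require Import zify ring.

(** The idea is the antipode. Let [tensor_rev] reverse the order of the factors
    of an algebraic tensor and put [alpha = (-1)^k tensor_rev] in degree [k].
    Reversal is an anti-automorphism of the tensor algebra ([tensor_rev_amul]),
    and it is isometric in each degree, because every tensor of positive degree
    is a sum of pure tensors and the norm is invariant under permutation of the
    factors of such sums ([norm_tensor_rev]). So [alpha] is an isometric
    anti-automorphism.

    By induction on the length of the brackets, [alpha] sends a Lie element
    [l] to [- l] ([tensor_rev_lie]). An anti-automorphism commutes with powers
    of one element, hence [alpha (exp l) = exp (- l)], and this is the inverse
    of [exp l] ([exp_truncN]). Therefore [exp l] and its inverse have the same
    norm in every degree ([norm_exp_inv]).

    To pass to the closure, write the inverse of [g] as the finite geometric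
    sum of the powers of [1 - g], which is nilpotent. This sum depends
    continuously on [g], so the set of [g] such that [g] and its inverse have
    equal norms in degree [k] is closed. It contains the exponentials, hence
    also their closure.

    The products of the completed tensor powers are associative and unital by
    density of the algebraic tensors, which makes the truncated series an
    algebra over [R]; the computations with exponentials and geometric sums take
    place in that algebra. The antipode itself enters as a relation between
    series: [antipodal a b] says that [a] comes from algebraic tensors and that
    [b] is its image by [alpha]. *)

Set Implicit Arguments.
Unset Strict Implicit.
Unset Printing Implicit Defensive.

Import Order.TTheory GRing.Theory Num.Theory.
Import numFieldNormedType.Exports.

Local Open Scope classical_set_scope.
Local Open Scope ring_scope.

(** * Consequences of the universal property of tensor powers *)

Section LinearPacking.
Context {R : realType} {U W : lmodType R}.

(** Gives access to the theory of bundled linear maps for maps that are only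
    known to satisfy the proposition [linear]. *)
Definition linear_pack (f : U -> W) (lf : linear f) : {linear U -> W} :=
  HB.pack f (GRing.isLinear.Build R U W *:%R f lf).

Variables (f : U -> W) (lf : linear f).

Lemma lin0 : f 0 = 0. Proof. exact: (linear0 (linear_pack lf)). Qed.
Lemma linD : {morph f : x y / x + y}.
Proof. exact: (linearD (linear_pack lf)). Qed.
Lemma linN : {morph f : x / - x}. Proof. exact: (linearN (linear_pack lf)). Qed.
Lemma linZ a : {morph f : x / a *: x}.
Proof. exact: (linearZ_LR (linear_pack lf)). Qed.
Lemma lin_sum I r (P : pred I) E :
  f (\sum_(i <- r | P i) E i) = \sum_(i <- r | P i) f (E i).
Proof. exact: (linear_sum (linear_pack lf)). Qed.

End LinearPacking.

Section SubLmodule.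
Context {R : realType} {A : lmodType R}.
Variable S : submodClosed A.

(** A submodule as a module in its own right, to serve as a target in the
    universal property. *)
Inductive sub_lmod := SubLmod x & x \in S.
Definition sub_lmod_val u := let: SubLmod x _ := u in x.

HB.instance Definition _ := [isSub for sub_lmod_val].
HB.instance Definition _ := [Choice of sub_lmod by <:].
HB.instance Definition _ := [SubChoice_isSubLmodule of sub_lmod by <:].

End SubLmodule.

Section TensorPower.
Context {R : realType} {V A : lmodType R} {k : nat} {t : ('I_k -> V) -> A}.
Hypothesis tP : is_tensor_power t.

Lemma tensor_ext (W : lmodType R) (f g : A -> W) :
  linear f -> linear g -> (forall v, f (t v) = g (t v)) -> f =1 g.
Proof.
move=> lf lg fg.
have mf : multilinear (f \o t).
  by move=> i v a x y /=; rewrite tP.1 lf.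
have [h [_ hU]] := tP.2 W (f \o t) mf.
have hf : h = f by apply: hU.
have hg : h = g by apply: hU; split=> // v; rewrite -fg.
by move=> x; rewrite -hf hg.
Qed.

(** Pure tensors span. Corestrict [t] to the submodule [S] and lift it to a
    linear map [g : A -> S]. Followed by the inclusion, [g] fixes every pure
    tensor, so by uniqueness it is the identity, and every [x] is in [S]. *)
Lemma tensor_ind (S : {pred A}) :
  submod_closed S -> (forall v, t v \in S) -> forall x, x \in S.
Proof.
move=> Scl St x.
pose S' : submodClosed A :=
  HB.pack S (GRing.isSubmodClosed.Build R A S Scl).
pose U := sub_lmod S'.
pose s (v : 'I_k -> V) : U := SubLmod (St v : t v \in S').
have ms : multilinear s.
  move=> i v a y z; apply: val_inj; rewrite GRing.valD GRing.valZ.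
  exact: tP.1.
have [g [[lg gs] _]] := tP.2 _ s ms.
have : (val \o g) x = id x.
  apply: tensor_ext => [|//|v /=]; last by rewrite gs.
  by move=> a y z /=; rewrite lg GRing.valD GRing.valZ.
by move=> <-; apply: (valP (g x)).
Qed.

End TensorPower.

(** In positive degree a scalar can be absorbed in the first factor, so plain
    sums suffice. *)
Lemma tensor_sum_pure (R : realType) (V A : lmodType R) (k : nat)
    (t : ('I_k.+1 -> V) -> A) (tP : is_tensor_power t) (x : A) :
  exists (N : nat) (v : 'I_N -> 'I_k.+1 -> V), x = \sum_(j < N) t (v j).
Proof.
pose S : {pred A} := fun x => `[< exists (N : nat) (v : 'I_N -> 'I_k.+1 -> V),
  x = \sum_(j < N) t (v j) >].
suff: x \in S by move/asboolP.
apply: (tensor_ind tP) => [|v]; last first.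
  by apply/asboolP; exists 1%N, (fun=> v); rewrite big_ord1.
split.
  apply/asboolP; exists 0%N, (fun=> 0); by rewrite big_ord0.
move=> a y z /asboolP [M [v ->]] /asboolP [N [w ->]]; apply/asboolP.
pose av j := upd (v j) ord0 (a *: v j ord0).
exists (M + N)%N,
  (fun i => match fintype.split i with inl j => av j | inr j => w j end).
rewrite big_split_ord scaler_sumr /=; congr (_ + _); apply: eq_bigr => j _.
  rewrite (unsplitK (inl _ j)) /av.
  have updE u : upd u ord0 (u ord0) = u.
    by apply/funext => i; rewrite /upd; case: eqP => [->|].
  have t0 : t (upd (v j) ord0 0) = 0.
    have := tP.1 ord0 (v j) (-1) 0 0.
    by rewrite scaler0 add0r scaleN1r addNr.
  have := tP.1 ord0 (v j) a (v j ord0) 0.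
  by rewrite addr0 t0 addr0 updE => <-.
by rewrite (unsplitK (inr _ j)).
Qed.

Lemma bilinear_ext (R : realType) (V A B W : lmodType R) (m n : nat)
    (s : ('I_m -> V) -> A) (t : ('I_n -> V) -> B) (f g : A -> B -> W) :
    is_tensor_power s -> is_tensor_power t ->
    bilinear_map f -> bilinear_map g ->
  (forall v w, f (s v) (t w) = g (s v) (t w)) -> forall x y, f x y = g x y.
Proof.
move=> sP tP [fl fr] [gl gr] fg x y.
apply: (tensor_ext sP (fl y) (gl y)) => v.
exact: (tensor_ext tP (fr _) (gr _)).
Qed.

(** * Transport between equal degrees *)

Section Cast.
Context {R : realType}.
Variable F : nat -> lmodType R.

Lemma ecast_linear m k (e : m = k) : linear (fun x : F m => ecast i (F i) e x).
Proof. by case: k / e. Qed.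

Lemma ecast_irr m k (e e' : m = k) (x : F m) :
  ecast i (F i) e x = ecast i (F i) e' x.
Proof. by rewrite (eq_irrelevance e e'). Qed.

Lemma ecast_ecast m k l (e : m = k) (e' : k = l) (x : F m) :
  ecast i (F i) e' (ecast i (F i) e x) = ecast i (F i) (etrans e e') x.
Proof. by case: l / e'. Qed.

End Cast.

(** * Reversal of tensors *)

Section Reversal.
Context {R : realType} {V : completeNormedModType R} (T : tensor_norms V).

Lemma ecast_tens m k (e : m = k) (v : 'I_m -> V) :
  ecast i (atp T i) e (tens T v) = tens T (fun i => v (cast_ord (esym e) i)).
Proof.
case: k / e => /=; congr (tens T _); apply/funext => i; congr v.
exact: val_inj.
Qed.

Lemma rev_exists k : exists r : atp T k -> atp T k,
  linear r /\ forall v, r (tens T v) = tens T (v \o @rev_ord k).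
Proof.
have [|r [rP _]] := (tensP T k).2 (atp T k) (fun v => tens T (v \o @rev_ord k)).
  move=> i v a x y.
  have updE z : upd v i z \o @rev_ord k = upd (v \o @rev_ord k) (rev_ord i) z.
    by apply/funext => j; rewrite /upd /= (can2_eq rev_ordK rev_ordK).
  by rewrite !updE; apply: (tensP T k).1.
by exists r.
Qed.

Definition tensor_rev k : atp T k -> atp T k := sval (cid (rev_exists k)).

Lemma tensor_rev_linear k : linear (@tensor_rev k).
Proof. exact: (svalP (cid (rev_exists k))).1. Qed.

Lemma tensor_rev_tens k v : @tensor_rev k (tens T v) = tens T (v \o @rev_ord k).
Proof. exact: (svalP (cid (rev_exists k))).2. Qed.

Lemma tensor_rev_small k : (k <= 1)%N -> forall x : atp T k, tensor_rev x = x.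
Proof.
move=> k1 x; apply: (tensor_ext (tensP T k) (@tensor_rev_linear k) (g := id)).
  by [].
move=> v; rewrite tensor_rev_tens; congr (tens T _); apply/funext => i /=.
congr v; apply: val_inj => /=; have := ltn_ord i.
by case: k k1 {x v} i => [|[|//]] _ [[|i]].
Qed.

(** Where the symmetry of the norms enters; in degree 0 scalars cannot be
    absorbed in a factor, but there reversal is the identity. *)
Lemma norm_tensor_rev k (x : atp T k) : `|tensor_rev x| = `|x|.
Proof.
case: k x => [|k] x; first by rewrite tensor_rev_small.
have [N [v ->]] := tensor_sum_pure (tensP T k.+1) x.
rewrite (lin_sum (@tensor_rev_linear k.+1)) (norm_perm T (perm rev_ord_inj) v).
congr (`|_|); apply: eq_bigr => j _; rewrite tensor_rev_tens; congr (tens T _).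
by apply/funext => i /=; rewrite permE.
Qed.

Lemma fcat_rev (X : Type) m n (v : 'I_m -> X) (w : 'I_n -> X) :
  fcat v w \o @rev_ord (m + n) =
  fun i => fcat (w \o @rev_ord n) (v \o @rev_ord m) (cast_ord (addnC m n) i).
Proof.
apply/funext => i; rewrite /fcat /=.
have := ltn_ord i.
case: fintype.splitP => j /= ij; case: fintype.splitP => l /= il im.
- have := ltn_ord j; have := ltn_ord l; lia.
- by congr v; apply: val_inj => /=; have := ltn_ord j; have := ltn_ord l; lia.
- by congr w; apply: val_inj => /=; have := ltn_ord j; have := ltn_ord l; lia.
- have := ltn_ord j; have := ltn_ord l; lia.
Qed.

Lemma tensor_rev_amul m n (x : atp T m) (y : atp T n) :
  tensor_rev (amul x y) =
  ecast i (atp T i) (addnC n m) (amul (tensor_rev y) (tensor_rev x)).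
Proof.
move: x y; apply: (bilinear_ext (tensP T m) (tensP T n)).
- split=> z a x y; first by rewrite (amul_bilinear T m n).1 tensor_rev_linear.
  by rewrite (amul_bilinear T m n).2 tensor_rev_linear.
- split=> z a x y; rewrite tensor_rev_linear.
    by rewrite (amul_bilinear T n m).2 (ecast_linear (F := atp T)).
  by rewrite (amul_bilinear T n m).1 (ecast_linear (F := atp T)).
- move=> v w; rewrite amul_tens !tensor_rev_tens amul_tens ecast_tens fcat_rev.
  congr (tens T _); apply/funext => i; congr (fcat _ _ _); exact: val_inj.
Qed.

Lemma tensor_rev_ecast m k (e : m = k) (x : atp T m) :
  tensor_rev (ecast i (atp T i) e x) = ecast i (atp T i) e (tensor_rev x).
Proof. by case: k / e. Qed.

(** Reversal exchanges the two terms of a bracket, which contributes one sign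
    per bracket. *)
Lemma tensor_rev_lie k (x : atp T k.+1) :
  lie_power x -> tensor_rev x = (-1) ^+ k *: x.
Proof.
elim: k x => [|k IH] x /=.
  by move=> _; rewrite expr0 scale1r tensor_rev_small.
move=> [N [c [s [sP ->]]]].
rewrite (lin_sum (@tensor_rev_linear _)) scaler_sumr; apply: eq_bigr => i _.
rewrite (linZ (@tensor_rev_linear _)) scalerA mulrC -scalerA; congr (_ *: _).
have [a [b [aP ->]]] := sP i.
(* In degree 1 reversal is the identity, so only [a] contributes a sign. *)
rewrite /bracket (linD (@tensor_rev_linear _)) (linN (@tensor_rev_linear _)).
rewrite tensor_rev_ecast tensor_rev_amul.
rewrite -[tensor_rev (amul b a)]/(@tensor_rev (1 + k.+1) (amul b a)).
rewrite tensor_rev_amul IH // (tensor_rev_small (leqnn 1)).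
rewrite (linZ ((amul_bilinear T _ _).1 _)) (linZ ((amul_bilinear T _ _).2 _)).
rewrite !(linZ (ecast_linear (F := atp T) _)) ecast_ecast.
rewrite (ecast_irr (F := atp T) _ erefl).
rewrite (ecast_irr (F := atp T) (addnC k.+1 1) (addn1 k.+1)).
by rewrite exprS mulN1r scaleNr -scalerN opprB scalerBr.
Qed.

End Reversal.

(** * Exponentials of nilpotent elements *)

Definition exp_trunc (R : realType) (A : algType R) (n : nat) (x : A) : A :=
  \sum_(j < n.+1) (j`!%:R : R)^-1 *: x ^+ j.

(** Both factors are the values at [x] of truncated exponential polynomials. The
    product of these polynomials is [1] modulo ['X^n.+1] by the binomial formula
    for [(-1 + 1) ^+ m]. *)
Lemma exp_truncN (R : realType) (A : algType R) (n : nat) (x : A) :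
  x ^+ n.+1 = 0 -> exp_trunc n x * exp_trunc n (- x) = 1.
Proof.
move=> xn0.
pose p : {poly R} := \poly_(j < n.+1) (j`!%:R)^-1.
pose q : {poly R} := \poly_(j < n.+1) ((-1) ^+ j / j`!%:R).
have -> : exp_trunc n x = horner_alg x p.
  rewrite /p poly_def raddf_sum; apply: eq_bigr => j _ /=.
  by rewrite linearZ rmorphXn /= horner_algX mulr_algl.
have -> : exp_trunc n (- x) = horner_alg x q.
  rewrite /q poly_def raddf_sum; apply: eq_bigr => j _ /=.
  rewrite linearZ rmorphXn /= horner_algX mulr_algl (exprNn x) mulrC -scalerA.
  congr (_ *: _).
  by rewrite -signr_odd -[in RHS]signr_odd mulr_sign scaler_sign; case: odd.
rewrite -rmorphM -(poly_take_drop n.+1 (p * q)) rmorphD rmorphM rmorphXn /=.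
rewrite horner_algX xn0 mulr0 addr0.
suff -> : take_poly n.+1 (p * q) = 1 by rewrite rmorph1.
apply/polyP => m; rewrite coef_take_poly coef1.
case: ltnP => [mn|]; last by case: m.
rewrite coefM.
have fact_neq0 i : (i`!%:R : R) != 0 by rewrite pnatr_eq0 -lt0n fact_gt0.
transitivity ((m`!%:R)^-1 * (-1 + 1 : R) ^+ m).
  rewrite exprDn mulr_sumr; apply: eq_bigr => [[j /= jm]] _.
  rewrite !coef_poly (leq_ltn_trans _ mn) // (leq_ltn_trans (leq_subr _ _) mn).
  rewrite expr1n mulr1 -mulr_natr.
  have := bin_fact (jm : (j <= m)%N) => /(congr1 (fun k => k%:R : R)).
  rewrite !natrM => e; rewrite -e.
  have b0 : ('C(m, j)%:R : R) != 0 by rewrite pnatr_eq0 -lt0n bin_gt0.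
  by field; rewrite b0 !fact_neq0.
rewrite addNr expr0n; case: m mn => [|m] _; rewrite ?mulr0 //=.
by rewrite fact0 invr1 mulr1.
Qed.

(** * Multiplication of the completed tensor powers *)

Section Completion.
Context {R : realType} {V : completeNormedModType R} {T : tensor_norms V}.
Variable C : tensor_completion T.

Lemma amulA m n p (x : atp T m) (y : atp T n) (z : atp T p) :
  amul (amul x y) z =
  ecast i (atp T i) (addnA m n p) (amul x (amul y z)).
Proof.
have al := fun m n => (amul_bilinear T m n).1.
have ar := fun m n => (amul_bilinear T m n).2.
have el := ecast_linear (F := atp T).
apply: (tensor_ext (tensP T m) (f := fun x => amul (amul x y) z)
  (g := fun x => ecast i (atp T i) (addnA m n p) (amul x (amul y z)))).
- by move=> a u v; rewrite al al.
- by move=> a u v; rewrite al el.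
move=> u; move: y z; apply: (bilinear_ext (tensP T n) (tensP T p)).
- by split=> v a s t; [rewrite ar al | rewrite ar].
- by split=> v a s t; [rewrite al ar el | rewrite !ar el].
move=> v w; rewrite !amul_tens ecast_tens; congr (tens T _).
apply/funext => i; rewrite /fcat.
have := ltn_ord i.
case: fintype.splitP => j ij; last first.
  case: fintype.splitP => l /= il; last case: fintype.splitP => r /= lr im.
  - have := ltn_ord l; lia.
  - have := ltn_ord r; lia.
  - congr w; apply: val_inj => /=; lia.
case: fintype.splitP => r /= jr; case: fintype.splitP => l /= il im.
- congr u; apply: val_inj => /=; lia.
- have := ltn_ord r; lia.
- have := ltn_ord l; lia.
- case: fintype.splitP => q /= lq.
    congr v; apply: val_inj => /=; lia.
  have := ltn_ord j; lia.
Qed.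

Definition tunit : atp T 0 := tens T (fun i : 'I_0 => 0).

Lemma amul1x m (x : atp T m) : amul tunit x = x.
Proof.
apply: (tensor_ext (tensP T m) (g := id) ((amul_bilinear T 0 m).2 _)) => // v.
rewrite amul_tens; congr (tens T _); apply/funext => i; rewrite /fcat.
case: fintype.splitP => [[]//|j ij]; congr v; exact: val_inj.
Qed.

Lemma amulx1 m (x : atp T m) :
  amul x tunit = ecast i (atp T i) (esym (addn0 m)) x.
Proof.
apply: (tensor_ext (tensP T m) ((amul_bilinear T m 0).1 _)
  (ecast_linear (F := atp T) _)) => v.
rewrite amul_tens ecast_tens; congr (tens T _); apply/funext => i.
rewrite /fcat.
case: fintype.splitP => [j ij|[]//]; congr v; exact: val_inj.
Qed.

(** Continuous maps are determined by their values on algebraic tensors, by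
    density: the points where [f] and [g] differ form an open set. *)
Lemma emb_ext k (W : normedModType R) (f g : ctp C k -> W) :
  continuous f -> continuous g -> (forall a, f (emb C a) = g (emb C a)) ->
  f =1 g.
Proof.
move=> fc gc fg x; apply/eqP; apply: contrapT => /negP fgx.
pose h y := `|f y - g y|.
have hc : continuous h.
  by move=> y; apply: cvg_norm; apply: cvgB; [exact: fc|exact: gc].
have oO : open (h @^-1` ~` [set y | y = 0]).
  apply: open_comp => [y _|]; first exact: hc.
  by apply: closed_openC; exact: closed_eq.
have [|y [+ [a _ ya]]] := @emb_dense _ _ _ C k _ _ oO.
  by exists x => /=; apply/eqP; rewrite normr_eq0 subr_eq0.
by apply; rewrite /h -ya fg subrr normr0.
Qed.

Lemma emb_ecast m k (e : m = k) (x : atp T m) :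
  ecast i (ctp C i) e (emb C x) = emb C (ecast i (atp T i) e x).
Proof. by case: k / e. Qed.

Lemma ecast_continuous m k (e : m = k) :
  continuous (fun x : ctp C m => ecast i (ctp C i) e x).
Proof. by case: k / e => x; apply: cvg_id. Qed.

Lemma cmul_continuous_comp (X : topologicalType) m n
    (f : X -> ctp C m) (g : X -> ctp C n) :
  continuous f -> continuous g -> continuous (fun x => cmul (f x) (g x)).
Proof.
move=> fc gc x; apply: (@continuous2_cvg _ _ _ _ _ _ f g (fun a b => cmul a b)).
- exact: (@cmul_continuous _ _ _ C m n (f x, g x)).
- exact: fc.
- exact: gc.
Qed.

Lemma ecast_continuous_comp (X : topologicalType) m k (e : m = k)
    (f : X -> ctp C m) :
  continuous f -> continuous (fun x => ecast i (ctp C i) e (f x)).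
Proof. by case: k / e. Qed.

Lemma cmulA m n p (x : ctp C m) (y : ctp C n) (z : ctp C p) :
  cmul (cmul x y) z =
  ecast i (ctp C i) (addnA m n p) (cmul x (cmul y z)).
Proof.
have idc k : continuous (fun u : ctp C k => u) by move=> ?; exact: cvg_id.
have cc k (u : ctp C k) l : continuous (fun _ : ctp C l => u).
  by move=> ?; exact: cvg_cst.
apply: (emb_ext (f := fun x => cmul (cmul x y) z)
  (g := fun x => ecast i (ctp C i) (addnA m n p) (cmul x (cmul y z)))).
- by do ?[exact: idc | exact: cc | apply: cmul_continuous_comp].
- apply: ecast_continuous_comp.
  by do ?[exact: idc | exact: cc | apply: cmul_continuous_comp].
move=> a.
apply: (emb_ext (f := fun y => cmul (cmul (emb C a) y) z)
  (g := fun y => ecast i (ctp C i) (addnA m n p) (cmul (emb C a) (cmul y z)))).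
- by do ?[exact: idc | exact: cc | apply: cmul_continuous_comp].
- apply: ecast_continuous_comp.
  by do ?[exact: idc | exact: cc | apply: cmul_continuous_comp].
move=> b.
apply: (emb_ext (f := fun z => cmul (cmul (emb C a) (emb C b)) z)
  (g := fun z => ecast i (ctp C i) (addnA m n p)
                   (cmul (emb C a) (cmul (emb C b) z)))).
- by do ?[exact: idc | exact: cc | apply: cmul_continuous_comp].
- apply: ecast_continuous_comp.
  by do ?[exact: idc | exact: cc | apply: cmul_continuous_comp].
by move=> c; rewrite !cmul_emb amulA emb_ecast.
Qed.

Lemma cmul1x m (x : ctp C m) : cmul (emb C tunit) x = x.
Proof.
apply: (emb_ext (g := id)) => [|x'|a]; last by rewrite cmul_emb amul1x.
  by apply: cmul_continuous_comp => u; [exact: cvg_cst|exact: cvg_id].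
exact: cvg_id.
Qed.

Lemma cmulx1 m (x : ctp C m) :
  cmul x (emb C tunit) = ecast i (ctp C i) (esym (addn0 m)) x.
Proof.
apply: (emb_ext (f := fun x => cmul x (emb C tunit))
  (g := fun x => ecast i (ctp C i) (esym (addn0 m)) x)) => [||a].
- by apply: cmul_continuous_comp => u; [exact: cvg_id|exact: cvg_cst].
- exact: ecast_continuous.
- by rewrite cmul_emb amulx1 emb_ecast.
Qed.

(** A total version of the transport [ecast]: it is zero when the degrees
    differ. It turns sums over pairs of degrees with a prescribed total into
    sums over all pairs. *)
Definition degree_cast m k (x : ctp C m) : ctp C k :=
  match m =P k with
  | ReflectT e => ecast i (ctp C i) e x
  | ReflectF _ => 0
  end.

Lemma degree_castE m k (e : m = k) (x : ctp C m) :
  degree_cast k x = ecast i (ctp C i) e x.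
Proof.
rewrite /degree_cast; case: eqP => // e'; exact: (ecast_irr (F := ctp C)).
Qed.

Lemma degree_cast_id m (x : ctp C m) : degree_cast m x = x.
Proof. by rewrite (degree_castE erefl). Qed.

Lemma degree_cast_neq m k (x : ctp C m) : m <> k -> degree_cast k x = 0.
Proof. by rewrite /degree_cast; case: eqP. Qed.

Lemma degree_cast_linear m k : linear (@degree_cast m k).
Proof.
move=> a x y; rewrite /degree_cast; case: eqP => [e|_].
  exact: (ecast_linear (F := ctp C)).
by rewrite scaler0 addr0.
Qed.

Lemma degree_cast_continuous m k : continuous (@degree_cast m k).
Proof.
rewrite /degree_cast; case: eqP => [e|_]; first exact: ecast_continuous.
by move=> x; exact: cvg_cst.
Qed.

Lemma degree_cast_ecast m k l (e : m = k) (x : ctp C m) :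
  degree_cast l (ecast i (ctp C i) e x) = degree_cast l x.
Proof. by case: k / e. Qed.

End Completion.

(** * The algebra of truncated series *)

Section SeriesAlgebra.
Context {R : realType} {V : completeNormedModType R} {T : tensor_norms V}.
Variables (C : tensor_completion T) (n : nat).
Implicit Types a b c : tseries C n.

Lemma tseries_ext a b : (forall k, a k = b k) -> a = b.
Proof. exact: functional_extensionality_dep. Qed.

Lemma cmul_suml m p I (r : seq I) (x : I -> ctp C m) (y : ctp C p) :
  cmul (\sum_(i <- r) x i) y = \sum_(i <- r) cmul (x i) y.
Proof. exact: (lin_sum ((cmul_bilinear C m p).1 y)). Qed.

Lemma cmul_sumr m p I (r : seq I) (x : ctp C m) (y : I -> ctp C p) :
  cmul x (\sum_(i <- r) y i) = \sum_(i <- r) cmul x (y i).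
Proof. exact: (lin_sum ((cmul_bilinear C m p).2 x)). Qed.

Lemma degree_cast_sum m k I (r : seq I) (x : I -> ctp C m) :
  degree_cast k (\sum_(i <- r) x i) = \sum_(i <- r) degree_cast k (x i).
Proof. exact: (lin_sum (@degree_cast_linear _ _ _ C m k)). Qed.

Lemma degree_cast0 m k : degree_cast k (0 : ctp C m) = 0.
Proof. exact: (lin0 (@degree_cast_linear _ _ _ C m k)). Qed.

Lemma cmul0l m p (y : ctp C p) : cmul (0 : ctp C m) y = 0.
Proof. exact: (lin0 ((cmul_bilinear C m p).1 y)). Qed.

Lemma cmul0r m p (x : ctp C m) : cmul x (0 : ctp C p) = 0.
Proof. exact: (lin0 ((cmul_bilinear C m p).2 x)). Qed.

(** The product as a sum over a square of degrees that does not depend on [k];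
    double sums of this form can be exchanged freely. *)
Lemma tmulE a b (k : 'I_n.+1) :
  tmul a b k = \sum_(i < n.+1) \sum_(j < n.+1) degree_cast k (cmul (a i) (b j)).
Proof.
rewrite [RHS](bigID (fun i : 'I_n.+1 => (i < k.+1)%N)) /=.
rewrite [X in _ + X]big1 ?addr0 => [|i ik]; last first.
  by apply: big1 => j _; apply: degree_cast_neq; lia.
rewrite (big_ord_narrow (ltn_ord k)); apply: eq_bigr => i _.
rewrite (bigD1 (@le_ord n k (sub_ord i))) //=.
rewrite [X in _ + X]big1 ?addr0 => [|j ji].
  by rewrite -degree_castE.
apply: degree_cast_neq => /= e; move/eqP: ji; apply; apply: val_inj => /=.
have := ltn_ord i; lia.
Qed.

(** The sum runs over degrees at most [n] only; nothing is lost when [m] exceeds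
    [n], because then [m + q] cannot be the degree [k]. *)
Lemma sum_degree_castl m q (x : ctp C m) (y : ctp C q) (k : 'I_n.+1) :
  \sum_(p < n.+1) degree_cast k (cmul (degree_cast p x) y) =
  degree_cast k (cmul x y).
Proof.
have [mn|nm] := ltnP m n.+1.
  rewrite (bigD1 (Ordinal mn)) //= degree_cast_id big1 ?addr0 // => p pm.
  rewrite (degree_cast_neq x) ?cmul0l ?degree_cast0 // => e.
  by move/eqP: pm; apply; apply: val_inj.
rewrite (@degree_cast_neq _ _ _ _ (m + q)); last by have := ltn_ord k; lia.
apply: big1 => p _; rewrite (degree_cast_neq x) ?cmul0l ?degree_cast0 //.
by have := ltn_ord p; lia.
Qed.

Lemma sum_degree_castr m q (x : ctp C m) (y : ctp C q) (k : 'I_n.+1) :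
  \sum_(p < n.+1) degree_cast k (cmul x (degree_cast p y)) =
  degree_cast k (cmul x y).
Proof.
have [mn|nm] := ltnP q n.+1.
  rewrite (bigD1 (Ordinal mn)) //= degree_cast_id big1 ?addr0 // => p pm.
  rewrite (degree_cast_neq y) ?cmul0r ?degree_cast0 // => e.
  by move/eqP: pm; apply; apply: val_inj.
rewrite (@degree_cast_neq _ _ _ _ (m + q)); last by have := ltn_ord k; lia.
apply: big1 => p _; rewrite (degree_cast_neq y) ?cmul0r ?degree_cast0 //.
by have := ltn_ord p; lia.
Qed.

(** Both sides are the sum of the products over all triples of degrees. *)
Lemma tmulA : associative (@tmul _ _ _ C n).
Proof.
move=> a b c; apply: tseries_ext => k.
transitivity (\sum_(i < n.+1) \sum_(j < n.+1) \sum_(r < n.+1)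
    degree_cast k (cmul (cmul (a i) (b j)) (c r))).
  rewrite tmulE; apply: eq_bigr => i _.
  transitivity (\sum_(p < n.+1) \sum_(j < n.+1) \sum_(r < n.+1)
      degree_cast k (cmul (a i) (degree_cast p (cmul (b j) (c r))))).
    apply: eq_bigr => p _; rewrite tmulE cmul_sumr degree_cast_sum.
    by apply: eq_bigr => j _; rewrite cmul_sumr degree_cast_sum.
  rewrite exchange_big; apply: eq_bigr => j _.
  rewrite exchange_big; apply: eq_bigr => r _.
  by rewrite sum_degree_castr cmulA degree_cast_ecast.
rewrite tmulE [RHS]exchange_big /=.
rewrite [LHS](eq_bigr _ (fun i _ => exchange_big _ _ _ _ _ _)) /=.
rewrite exchange_big; apply: eq_bigr => r _.
transitivity (\sum_(p < n.+1) \sum_(i < n.+1) \sum_(j < n.+1)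
    degree_cast k (cmul (degree_cast p (cmul (a i) (b j))) (c r))); last first.
  apply: eq_bigr => p _; rewrite tmulE cmul_suml degree_cast_sum.
  by apply: eq_bigr => j _; rewrite cmul_suml degree_cast_sum.
rewrite [RHS]exchange_big; apply: eq_bigr => i _.
rewrite [RHS]exchange_big; apply: eq_bigr => j _.
by rewrite sum_degree_castl.
Qed.

Lemma tone_pos (k : 'I_n.+1) : k != ord0 -> tone C k = 0.
Proof. by case: k => [[|k]]. Qed.

Lemma tmul1 : left_id (@tone _ _ _ C n) (@tmul _ _ _ C n).
Proof.
move=> a; apply: tseries_ext => k.
rewrite tmulE (bigD1 ord0) //= [X in _ + X]big1 ?addr0 => [|i i0]; last first.
  by apply: big1 => j _; rewrite tone_pos // cmul0l degree_cast0.
under eq_bigr => j _ do rewrite [tone C ord0]/(emb C tunit) cmul1x.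
rewrite (bigD1 k) //= degree_cast_id big1 ?addr0 // => j jk.
by apply: degree_cast_neq => e; move/eqP: jk; apply; apply: val_inj.
Qed.

Lemma tmulr1 : right_id (@tone _ _ _ C n) (@tmul _ _ _ C n).
Proof.
move=> a; apply: tseries_ext => k.
rewrite tmulE exchange_big (bigD1 ord0) //=.
rewrite [X in _ + X]big1 ?addr0 => [|i i0]; last first.
  by apply: big1 => j _; rewrite tone_pos // cmul0r degree_cast0.
under eq_bigr => j _ do
  rewrite [tone C ord0]/(emb C tunit) cmulx1 degree_cast_ecast.
rewrite (bigD1 k) //= degree_cast_id big1 ?addr0 // => j jk.
by apply: degree_cast_neq => e; move/eqP: jk; apply; apply: val_inj.
Qed.

Definition tadd a b : tseries C n := fun k => a k + b k.
Definition topp a : tseries C n := fun k => - a k.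
Definition tzero : tseries C n := fun k => 0.
Definition tscale (x : R) a : tseries C n := fun k => x *: a k.

Lemma taddA : associative tadd.
Proof. by move=> a b c; apply: tseries_ext => k; apply: addrA. Qed.
Lemma taddC : commutative tadd.
Proof. by move=> a b; apply: tseries_ext => k; apply: addrC. Qed.
Lemma tadd0 : left_id tzero tadd.
Proof. by move=> a; apply: tseries_ext => k; apply: add0r. Qed.
Lemma taddN : left_inverse tzero topp tadd.
Proof. by move=> a; apply: tseries_ext => k; apply: addNr. Qed.

HB.instance Definition _ := Choice.copy (tseries C n)
  (prod_topology (fun k : 'I_n.+1 => ctp C k)).
HB.instance Definition _ :=
  GRing.isZmodule.Build (tseries C n) taddA taddC tadd0 taddN.

Lemma tmulDl : left_distributive (@tmul _ _ _ C n) +%R.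
Proof.
move=> a b c; apply: tseries_ext => k.
rewrite [RHS]/(tmul a c k + tmul b c k) !tmulE -[RHS]big_split.
apply: eq_bigr => i _ /=.
rewrite -[RHS]big_split; apply: eq_bigr => j _ /=.
by rewrite (linD ((cmul_bilinear C _ _).1 _))
  (linD (@degree_cast_linear _ _ _ C _ _)).
Qed.

Lemma tmulDr : right_distributive (@tmul _ _ _ C n) +%R.
Proof.
move=> a b c; apply: tseries_ext => k.
rewrite [RHS]/(tmul a b k + tmul a c k) !tmulE -[RHS]big_split.
apply: eq_bigr => i _ /=.
rewrite -[RHS]big_split; apply: eq_bigr => j _ /=.
by rewrite (linD ((cmul_bilinear C _ _).2 _))
  (linD (@degree_cast_linear _ _ _ C _ _)).
Qed.

Lemma tone_neq0 : @tone _ _ _ C n != 0.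
Proof.
apply/eqP => /(congr1 (fun a : tseries C n => `|a ord0|)).
rewrite [tone C ord0]/(emb C tunit) emb_isometry norm_tens0.
rewrite [X in `|X|]/(0 : ctp C 0) normr0.
by apply/eqP; rewrite oner_eq0.
Qed.

HB.instance Definition _ := GRing.Zmodule_isNzRing.Build (tseries C n)
  tmulA tmul1 tmulr1 tmulDl tmulDr tone_neq0.

Lemma tscaleA x y a : tscale x (tscale y a) = tscale (x * y) a.
Proof. by apply: tseries_ext => k; apply: scalerA. Qed.
Lemma tscale1 : left_id 1 tscale.
Proof. by move=> a; apply: tseries_ext => k; apply: scale1r. Qed.
Lemma tscaleDr : right_distributive tscale +%R.
Proof. by move=> x a b; apply: tseries_ext => k; apply: scalerDr. Qed.
Lemma tscaleDl a : {morph tscale^~ a : x y / x + y}.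
Proof. by move=> x y; apply: tseries_ext => k; apply: scalerDl. Qed.

HB.instance Definition _ := GRing.Zmodule_isLmodule.Build R (tseries C n)
  tscaleA tscale1 tscaleDr tscaleDl.

Lemma tscaleAl (x : R) a b : x *: (a * b) = (x *: a) * b.
Proof.
apply: tseries_ext => k.
change (x *: tmul a b k = tmul (tscale x a) b k).
rewrite !tmulE scaler_sumr; apply: eq_bigr => i _.
rewrite scaler_sumr; apply: eq_bigr => j _.
by rewrite (linZ ((cmul_bilinear C _ _).1 _))
  (linZ (@degree_cast_linear _ _ _ C _ _)).
Qed.

Lemma tscaleAr (x : R) a b : x *: (a * b) = a * (x *: b).
Proof.
apply: tseries_ext => k.
change (x *: tmul a b k = tmul a (tscale x b) k).
rewrite !tmulE scaler_sumr; apply: eq_bigr => i _.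
rewrite scaler_sumr; apply: eq_bigr => j _.
by rewrite (linZ ((cmul_bilinear C _ _).2 _))
  (linZ (@degree_cast_linear _ _ _ C _ _)).
Qed.

HB.instance Definition _ :=
  GRing.Lmodule_isLalgebra.Build R (tseries C n) tscaleAl.
HB.instance Definition _ :=
  GRing.Lalgebra_isAlgebra.Build R (tseries C n) tscaleAr.

End SeriesAlgebra.

(** * Powers, exponentials and inverses of series *)

Section Inverse.
Context {R : realType} {V : completeNormedModType R} {T : tensor_norms V}.
Context {C : tensor_completion T} {n : nat}.
Implicit Types a b g l : tseries C n.

Lemma tseries_sumE I (r : seq I) (F : I -> tseries C n) (k : 'I_n.+1) :
  (\sum_(i <- r) F i) k = \sum_(i <- r) F i k.
Proof. by elim: r => [|i r IH]; rewrite ?big_nil // !big_cons -IH. Qed.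

Lemma texpnE a j : texpn a j = a ^+ j.
Proof. by elim: j => [//|j IH]; rewrite exprS -IH. Qed.

Lemma texpE l : texp l = exp_trunc n l.
Proof.
apply: tseries_ext => k; rewrite /texp /exp_trunc.
by rewrite tseries_sumE; apply: eq_bigr => j _; rewrite texpnE.
Qed.

(** Each factor has no constant term, so it raises the degree by at least
    one. *)
Lemma texpn_low a (j : nat) (k : 'I_n.+1) :
  a ord0 = 0 -> (k < j)%N -> (a ^+ j) k = 0.
Proof.
move=> a0; elim: j k => [//|j IH] k kj; rewrite exprS.
rewrite [LHS]tmulE; apply: big1 => p _; apply: big1 => q _.
have [->|p0] := eqVneq p ord0; first by rewrite a0 cmul0l degree_cast0.
have p_gt0 : (0 < p)%N by rewrite lt0n.
have [e|/eqP ne] := eqVneq (p + q)%N k; last exact: degree_cast_neq.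
by rewrite IH ?cmul0r ?degree_cast0 //; lia.
Qed.

Lemma texpn_nilp a : a ord0 = 0 -> a ^+ n.+1 = 0.
Proof.
by move=> a0; apply: tseries_ext => k; exact: texpn_low.
Qed.

Lemma texp_tseries1 l : l ord0 = 0 -> tseries1 (texp l).
Proof.
move=> l0; rewrite /tseries1 /= texpE /exp_trunc tseries_sumE big_ord_recl.
rewrite big1 ?addr0 => [|j _].
  by rewrite fact0 invr1 scale1r expr0.
change ((bump 0 j)`!%:R^-1 *: (l ^+ bump 0 j) ord0 = 0).
by rewrite texpn_low ?scaler0.
Qed.

(** The geometric sum for the inverse of [g = 1 - (1 - g)]; the powers above
    [n] of [1 - g] vanish when [g] has constant term 1. *)
Definition geom_inv g : tseries C n := \sum_(i < n.+1) (1 - g) ^+ i.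

Lemma sub1_ord0 g : tseries1 g -> (1 - g) ord0 = 0.
Proof. by move=> g1; change (tone C ord0 - g ord0 = 0); rewrite g1 subrr. Qed.

Lemma mul_geom_inv g : tseries1 g -> g * geom_inv g = 1.
Proof.
move=> /sub1_ord0/texpn_nilp nilp; apply: oppr_inj.
by rewrite -mulNr -[- g](addKr 1) addrC -subrX1 nilp sub0r.
Qed.

Lemma geom_inv_comm g : GRing.comm g (geom_inv g).
Proof.
apply: commr_sum => i _; apply: commrX; apply: commrB => //; exact: commr1.
Qed.

Lemma geom_inv_tseries1 g : tseries1 g -> tseries1 (geom_inv g).
Proof.
move=> /sub1_ord0 g0; rewrite /tseries1 /= /geom_inv tseries_sumE big_ord_recl.
rewrite big1 ?addr0 ?expr0 // => j _; exact: texpn_low.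
Qed.

Lemma geom_inv_uniq g h : tseries1 g -> g * h = 1 -> h = geom_inv g.
Proof.
move=> g1 gh; rewrite -[h]mul1r -(mul_geom_inv g1) (geom_inv_comm g) -mulrA gh.
by rewrite mulr1.
Qed.

Lemma tinvE g : tseries1 g -> tinv g = geom_inv g.
Proof.
move=> g1; rewrite /tinv; case: xgetP => [h _ [_ gh _]|/(_ (geom_inv g)) []].
  exact: geom_inv_uniq.
split; [exact: geom_inv_tseries1|exact: mul_geom_inv|].
by have := mul_geom_inv g1; rewrite (geom_inv_comm g).
Qed.

End Inverse.

(** * The antipode *)

Section Antipode.
Context {R : realType} {V : completeNormedModType R} {T : tensor_norms V}.
Context {C : tensor_completion T} {n : nat}.
Implicit Types a b g l : tseries C n.

(** The graph of the antipode of the algebraic tensors, inside the square of the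
    completion. Unlike the antipode itself, the relation makes sense for all
    elements of the completion. *)
Definition antipode_rel k (u w : ctp C k) : Prop :=
  exists x : atp T k, u = emb C x /\ w = (-1) ^+ k *: emb C (tensor_rev x).

Lemma antipode_rel_norm k (u w : ctp C k) : antipode_rel u w -> `|u| = `|w|.
Proof.
by move=> [x [-> ->]]; rewrite normrZ normrX normrN1 expr1n mul1r
  !emb_isometry norm_tensor_rev.
Qed.

Lemma antipode_rel_lin k (c : R) (u w u' w' : ctp C k) :
  antipode_rel u w -> antipode_rel u' w' ->
  antipode_rel (c *: u + u') (c *: w + w').
Proof.
move=> [x [-> ->]] [y [-> ->]]; exists (c *: x + y).
rewrite tensor_rev_linear !(emb_linear C) scalerDr !scalerA; split=> //.
by rewrite [c * _]mulrC.
Qed.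

Lemma antipode_rel0 k : antipode_rel (0 : ctp C k) 0.
Proof.
exists 0; rewrite (lin0 (@tensor_rev_linear _ _ T k)).
by rewrite (lin0 (@emb_linear _ _ _ C k)) scaler0.
Qed.

Lemma antipode_relZ k (c : R) (u w : ctp C k) :
  antipode_rel u w -> antipode_rel (c *: u) (c *: w).
Proof.
by move=> uw; have := antipode_rel_lin c uw (antipode_rel0 k); rewrite !addr0.
Qed.

Lemma antipode_rel_sum k I (r : seq I) (F G : I -> ctp C k) :
  (forall i, antipode_rel (F i) (G i)) ->
  antipode_rel (\sum_(i <- r) F i) (\sum_(i <- r) G i).
Proof.
move=> FG; elim: r => [|i r IH].
  by rewrite !big_nil; exact: antipode_rel0.
rewrite !big_cons -[F i]scale1r -[G i]scale1r; exact: antipode_rel_lin.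
Qed.

Lemma antipode_rel_cast m k (u w : ctp C m) :
  antipode_rel u w -> antipode_rel (degree_cast k u) (degree_cast k w).
Proof.
have [<-|/eqP mk _] := eqVneq m k; first by rewrite !degree_cast_id.
by rewrite !degree_cast_neq //; exact: antipode_rel0.
Qed.

Lemma antipode_rel_mul m p (u w : ctp C m) (u' w' : ctp C p) :
  antipode_rel u w -> antipode_rel u' w' ->
  antipode_rel (cmul u u') (ecast i (ctp C i) (addnC p m) (cmul w' w)).
Proof.
move=> [x [-> ->]] [y [-> ->]]; exists (amul x y).
rewrite cmul_emb; split=> //.
rewrite (linZ ((cmul_bilinear C _ _).1 _)) (linZ ((cmul_bilinear C _ _).2 _)).
rewrite scalerA -exprD (linZ (ecast_linear (F := ctp C) _)) cmul_emb emb_ecast.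
by rewrite tensor_rev_amul; congr (_ ^+ _ *: _); exact: addnC.
Qed.

Definition antipodal a b := forall k, antipode_rel (a k) (b k).

Lemma antipodal_mul a a' b b' :
  antipodal a a' -> antipodal b b' -> antipodal (a * b) (b' * a').
Proof.
move=> aa bb k.
have -> : (a * b) k =
    \sum_(i < n.+1) \sum_(j < n.+1) degree_cast k (cmul (a i) (b j)).
  exact: tmulE.
have -> : (b' * a') k = \sum_(i < n.+1) \sum_(j < n.+1) degree_cast k
    (ecast m (ctp C m) (addnC j i) (cmul (b' j) (a' i))).
  rewrite [LHS]tmulE exchange_big; apply: eq_bigr => i _; apply: eq_bigr => j _.
  by rewrite degree_cast_ecast.
apply: antipode_rel_sum => i; apply: antipode_rel_sum => j.
apply: antipode_rel_cast; exact: antipode_rel_mul.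
Qed.

Lemma antipodal1 : antipodal 1 1.
Proof.
move=> k; have [->|k0] := eqVneq k ord0.
  by exists tunit; rewrite tensor_rev_small // expr0 scale1r.
have -> : (1 : tseries C n) k = 0 by exact: tone_pos.
exact: antipode_rel0.
Qed.

Lemma antipodalX a b j : antipodal a b -> antipodal (a ^+ j) (b ^+ j).
Proof.
move=> ab; elim: j => [|j IH]; first exact: antipodal1.
by rewrite exprS exprSr; exact: antipodal_mul.
Qed.

Lemma antipodal_exp a b : antipodal a b -> antipodal (texp a) (texp b).
Proof.
move=> ab k; apply: antipode_rel_sum => j; apply: antipode_relZ.
by rewrite !texpnE; exact: antipodalX.
Qed.

(** Reversal gives the sign [(-1) ^+ m] in degree [m.+1], the antipode gives
    [(-1) ^+ m.+1], and the two multiply to [-1]. *)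
Lemma antipodal_lie l : lie_algebra l -> antipodal l (- l).
Proof.
move=> lL k; have [x [xl e]] := lL k; exists x; split=> //.
change (- l k = (-1) ^+ k *: emb C (tensor_rev x)); rewrite e => {e}.
case: (k : nat) x xl => [|m] x /= xl.
  rewrite xl (lin0 (@tensor_rev_linear _ _ T 0)).
  by rewrite (lin0 (@emb_linear _ _ _ C 0)) scaler0 oppr0.
rewrite (tensor_rev_lie xl) (linZ (@emb_linear _ _ _ C _)) scalerA -exprD addSn.
by rewrite exprS addnn -signr_odd odd_double expr0 mulr1 scaleN1r.
Qed.

Lemma lie_ord0 l : lie_algebra l -> l ord0 = 0.
Proof.
by move=> /(_ ord0)[x [/= -> ->]]; exact: (lin0 (@emb_linear _ _ _ C 0)).
Qed.

(** The theorem on the dense set of exponentials, degree by degree. *)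
Lemma norm_exp_inv l k : lie_algebra l -> `|texp l k| = `|geom_inv (texp l) k|.
Proof.
move=> lL; have l0 := lie_ord0 lL.
have <- : texp (- l) = geom_inv (texp l).
  apply: geom_inv_uniq; first exact: texp_tseries1.
  by rewrite !texpE exp_truncN // texpn_nilp.
by apply: antipode_rel_norm; apply: antipodal_exp; exact: antipodal_lie.
Qed.

End Antipode.

(** * Continuity of the inverse *)

Section Continuity.
Context {R : realType} {V : completeNormedModType R} {T : tensor_norms V}.
Context {C : tensor_completion T} {n : nat}.
Implicit Types a b g l : tseries C n.

(** Continuity is stated component by component because each component of a
    product is a finite sum of continuous bilinear terms. *)
Definition ccontinuous (F : tseries C n -> tseries C n) :=
  forall k, continuous (fun g => F g k).

Lemma sum_continuous (X : topologicalType) (W : normedModType R) I (r : seq I)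
    (F : I -> X -> W) : (forall i, continuous (F i)) ->
  continuous (fun x => \sum_(i <- r) F i x).
Proof.
move=> Fc; elim: r => [|i r IH].
  by under eq_fun do rewrite big_nil; move=> x; exact: cvg_cst.
under eq_fun do rewrite big_cons.
by move=> x; apply: cvgD; [exact: Fc|exact: IH].
Qed.

Lemma continuous_proj : ccontinuous id.
Proof. by move=> k; exact: proj_continuous. Qed.

Lemma continuous_mul F G :
  ccontinuous F -> ccontinuous G -> ccontinuous (fun g => F g * G g).
Proof.
move=> Fc Gc k.
have -> : (fun g => (F g * G g) k) = (fun g =>
    \sum_(i < n.+1) \sum_(j < n.+1) degree_cast k (cmul (F g i) (G g j))).
  by apply/funext => g; exact: tmulE.
apply: sum_continuous => i; apply: sum_continuous => j g.
apply: (@continuous_comp _ _ _ (fun g => cmul (F g i) (G g j))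
  (@degree_cast _ _ _ C _ k)); last exact: degree_cast_continuous.
by apply: cmul_continuous_comp; [exact: Fc|exact: Gc].
Qed.

Lemma continuous_exp F j : ccontinuous F -> ccontinuous (fun g => F g ^+ j).
Proof.
move=> Fc; elim: j => [|j IH] k.
  by move=> g; apply: cvg_cst; exact: nbhs_filter.
have -> : (fun g => (F g ^+ j.+1) k) = (fun g => (F g * F g ^+ j) k).
  by apply/funext => g; rewrite exprS.
exact: continuous_mul.
Qed.

Lemma continuous_geom_inv : ccontinuous geom_inv.
Proof.
move=> k.
have -> : (fun g => geom_inv g k) = (fun g => \sum_(i < n.+1) ((1 - g) ^+ i) k).
  by apply/funext => g; exact: tseries_sumE.
apply: sum_continuous => i; apply: continuous_exp => m g.
apply: (@cvgB _ _ _ (nbhs g) (nbhs_filter g) (fun=> (1 : tseries C n) m)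
  (fun h : tseries C n => h m)); last exact: continuous_proj.
by apply: cvg_cst; exact: nbhs_filter.
Qed.

End Continuity.

Theorem lemma1p1 (R : realType) (V : completeNormedModType R)
    (T : tensor_norms V) (C : tensor_completion T) (n : nat) (hn : (1 <= n)%N)
    (g : tseries C n) (hg : lie_group g) :
  tnorm g = tnorm (tinv g).
Proof.
case: hg => g1 gcl; rewrite tinvE //.
suff ng k : `|g k| = `|geom_inv g k| by apply: eq_bigr => k _; rewrite ng.
pose f (a : tseries C n) : R := `|a k| - `|geom_inv a k|.
have fc : continuous f.
  have nc (F : tseries C n -> tseries C n) :
      ccontinuous F -> continuous (fun a => `|F a k|).
    move=> Fc a; apply: (@continuous_comp _ _ _ (fun a => F a k) Num.norm).
      exact: Fc.
    exact: norm_continuous.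
  move=> a; apply: (@cvgB _ _ _ (nbhs a) (nbhs_filter a)
    (fun b => `|b k|) (fun b => `|geom_inv b k|)).
    exact: (nc id continuous_proj).
  exact: (nc geom_inv continuous_geom_inv).
have D : closed (f @^-1` [set x | x = 0]).
  by apply: preimage_closed => [a _|]; [exact: fc|exact: closed_eq].
apply/eqP; rewrite -subr_eq0; apply/eqP; apply: D; apply: closureS gcl.
by move=> _ [l lL <-]; rewrite /= /f norm_exp_inv // subrr.
Qed.
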